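(* Let $Q\in\mathcal H_{\mathbb C}$ be a (complex) Hamiltonian matrix of size $2n\times 2n$ and let $\lambda$ be a simple eigenvalue of $Q$, with corresponding right and left eigenvectors $x,y\in\mathbb C^{2n}$ (that is, $Qx=\lambda x$, $y^*Q=\lambda y^*$) normalized to have $$\|x\|_2=\|y\|_2=1,\qquad \operatorname{Im}(y^*Jx)=0 .$$ Given any $E\in\mathcal H_{\mathbb C}$ with $\|E\|_F=1$, let $\lambda_E(t)$ be an eigenvalue of $Q+tE$ converging to $\lambda$ as $t\to 0$, and let $\dot\lambda_E(0)$ denote its derivative at $t=0$. Then $$|\dot\lambda_E(0)|\le \max\left\{\left|\frac{y^*Gx}{y^*x}\right| : \|G\|_F=1,\ G\in\mathcal H_{\mathbb C}\right\}=\frac{\|(yx^* )|_{\mathcal H_{\mathbb C}}\|_F}{|y^*x|}.$$ Moreover, $$\dot\lambda_E(0)=\pm\frac{\|(yx^* )|_{\mathcal H_{\mathbb C}}\|_F}{y^*x}\qquad\text{if}\qquad E=\pm\frac{(yx^* )|_{\mathcal H_{\mathbb C}}}{\|(yx^* )|_{\mathcal H_{\mathbb C}}\|_F}$$ (with corresponding signs).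
   Context: $J=\begin{pmatrix}0&I_n\\-I_n&0\end{pmatrix}$ is the fundamental symplectic matrix of size $2n\times 2n$. The set of complex Hamiltonian matrices is the real-linear space $\mathcal H_{\mathbb C}=\{Q\in\mathbb C^{2n\times 2n}: QJ=(QJ)^*\}$, where $^*$ denotes conjugate transpose. For $A\in\mathbb C^{2n\times 2n}$, put $A|_{\mathcal H_{\mathbb C}}=\frac12(A+JA^*J)$, the projection of $A$ onto $\mathcal H_{\mathbb C}$. $\|\cdot\|_F$ is the Frobenius norm and $\|\cdot\|_2$ the Euclidean norm. The parameter $t$ is real. *)

(* Defs.v *)
From mathcomp Require Import all_boot all_order all_algebra.
From mathcomp Require Export sesquilinear spectral.
From mathcomp Require Import all_classical all_reals all_analysis.
From mathcomp Require Export complex.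

Set Implicit Arguments.
Unset Strict Implicit.
Unset Printing Implicit Defensive.

Import Order.TTheory GRing.Theory Num.Theory.
Import numFieldNormedType.Exports.

Local Open Scope classical_set_scope.
Local Open Scope ring_scope.
Local Open Scope complex_scope.
Local Open Scope sesquilinear_scope.

(* Norms, like `|z| on R[i], take values in R[i]: they are nonnegative reals,
   on which the partial order of R[i] is the usual order.  The conjugate
   transpose is [A ^t*] from spectral.v. *)

Section Hamiltonian.
Variables (R : realType) (n : nat).

Definition sympJ : 'M[R[i]]_(n + n) := block_mx 0 1%:M (- 1%:M) 0.

Definition hamiltonian (Q : 'M[R[i]]_(n + n)) : Prop :=
  Q *m sympJ = (Q *m sympJ) ^t*.

Definition ham_proj (A : 'M[R[i]]_(n + n)) : 'M[R[i]]_(n + n) :=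
  2^-1 *: (A + sympJ *m A ^t* *m sympJ).

End Hamiltonian.

Arguments sympJ {R n}.

Definition frobenius_norm (R : realType) (m n : nat) (A : 'M[R[i]]_(m, n))
  : R[i] := sqrtC (\sum_i \sum_j `|A i j| ^+ 2).

Definition euclidean_norm (R : realType) (n : nat) (x : 'cV[R[i]]_n) : R[i] :=
  sqrtC (\sum_i `|x i 0| ^+ 2).

(* Simple = algebraic multiplicity one. *)
Definition simple_eigenvalue (R : realType) (n : nat) (Q : 'M[R[i]]_n)
    (lambda : R[i]) : Prop :=
  eigenvalue Q lambda /\ mup lambda (char_poly Q) = 1%N.

Definition scalar_of (R : realType) (A : 'M[R[i]]_1) : R[i] := A 0 0.

(* Derivative at [a] of a complex-valued function of a real variable; R[i] is
   not a normed space over R in the library, so [derive] does not apply.  The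
   alias R[i]^o carries the usual topology of R[i], induced by `|z|. *)
Definition is_cderive (R : realType) (f : R -> R[i]^o) (a : R) (d : R[i])
  : Prop :=
  (h^-1%:C * (f (a + h) - f a) : R[i]^o) @[h --> (0 : R)^'] --> (d : R[i]^o).

Definition is_maximum (R : realType) (S : set R[i]) (m : R[i]) : Prop :=
  S m /\ ubound S m.

(* Main.v *)
Require Import Defs.
From mathcomp Require Import all_boot all_order all_algebra.
From mathcomp Require Import all_classical all_reals all_analysis.
From mathcomp Require Import complex.
From mathcomp Require Import ring.

Import Order.TTheory GRing.Theory Num.Theory.
Import numFieldNormedType.Exports.

Local Open Scope classical_set_scope.
Local Open Scope ring_scope.
Local Open Scope complex_scope.
Local Open Scope sesquilinear_scope.

(* Let [u] be a row with [u x = 1].  Deflating the eigenpair [(lambda, x)] by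
   [Q + x u] turns the factor [X - lambda] of the characteristic polynomial into
   [X - lambda - 1], so [lambda - Q - x u] is invertible exactly because
   [lambda] is a simple root.  A left eigenvector [v] of [Q + t E] for [mu]
   satisfies [v C = - (v x) u] with [C = mu - (Q + t E) - x u], which eliminates
   [v] and gives [(mu - lambda) det C = - t (u adj(C) E x)]; dividing by [t] and
   letting [t] tend to 0 yields the derivative [y^* E x / y^* x].

   For the bound, put [a = y x^*] and [b = J a^* J], so that the projection of
   [a] is [P = (a + b) / 2].  For Hamiltonian [G] with [z = y^* G x], one has
   [<a, G> = z] and [<b, G> = conj z]; expanding
   [0 <= |z a + conj(z) b - 2 |z|^2 G|^2] gives [|z| <= |P|], where the
   normalization makes [<a, b> = (y^* J x)^2] a nonnegative real. *)

Set Implicit Arguments.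
Unset Strict Implicit.
Unset Printing Implicit Defensive.

(** * Rank-one updates and the characteristic polynomial *)

Lemma det_scalar_sub_rank1 (A : comNzRingType) (m : nat) (a : A) (x : 'cV[A]_m)
    (u : 'rV[A]_m) :
  \det (a%:M - x *m u) * a = (a - (u *m x) 0 0) * a ^+ m.
Proof.
(* Row and column elimination of the same bordered matrix. *)
pose D : 'M[A]_(1 + m) := block_mx 1%:M u x a%:M.
have rowE : block_mx 1%:M 0 (- x) 1%:M *m D =
    block_mx (1%:M : 'M[A]_1) u 0 (a%:M - x *m u).
  by rewrite mulmx_block !mul1mx !mul0mx !addr0 mulmx1 !mulNmx addNr addrC.
have colE : D *m block_mx a%:M 0 (- x) 1%:M =
    block_mx (a%:M - u *m x : 'M[A]_1) u 0 a%:M.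
  rewrite mulmx_block !mulmx1 !mulmx0 !add0r !mul1mx !mulmxN.
  by rewrite mul_mx_scalar mul_scalar_mx subrr.
have := congr1 determinant rowE; have := congr1 determinant colE.
rewrite !det_mulmx !det_lblock !det_ublock !det1 !det_scalar !expr1 !mulr1 !mul1r.
by rewrite det_mx11 !mxE /= => + <-.
Qed.

(** As [x] is an eigenvector, [X - Q] acts on it as [X - l]. Hence [(X - l) (X - Q - x u) = (X - Q)
    (X - l - x u)], and the last factor is a rank-one update of a scalar matrix. *)
Lemma char_poly_rank1_update (F : fieldType) (m : nat) (Q : 'M[F]_m)
    (l : F) (x : 'cV[F]_m) (u : 'rV[F]_m) :
  Q *m x = l *: x ->
  ('X - l%:P) * char_poly (Q + x *m u) =
    char_poly Q * ('X - (l + (u *m x) 0 0)%:P).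
Proof.
move=> Qx; pose a : {poly F} := 'X - l%:P.
pose xP := map_mx polyC x; pose uP := map_mx polyC u.
have a_neq0 : a != 0 by rewrite polyXsubC_eq0.
have QxP : char_poly_mx Q *m xP = a *: xP.
  rewrite /char_poly_mx mulmxBl mul_scalar_mx -map_mxM Qx /a scalerBl.
  by rewrite map_mxZ.
have E : a *: char_poly_mx (Q + x *m u) =
    char_poly_mx Q *m (a%:M - xP *m uP).
  rewrite mulmxBr mulmxA QxP mul_mx_scalar -scalemxAl -scalerBr.
  by rewrite /char_poly_mx map_mxD map_mxM opprD addrA.
have uxP : (uP *m xP) 0 0 = ((u *m x) 0 0)%:P.
  by rewrite -map_mxM mxE.
(* The extra factor [a] brings in the bordered-determinant identity; [a ^+ m] is then cancelled. *)
have := congr1 (fun M => \det M * a) E.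
rewrite detZ det_mulmx -[RHS]mulrA det_scalar_sub_rank1 uxP => H.
apply: (mulfI (expf_neq0 m a_neq0)) => /=.
rewrite polyCD opprD addrA -/a mulrA mulrAC {}H.
by rewrite mulrA mulrC.
Qed.

Lemma horner_char_poly (A : comNzRingType) (m : nat) (Q : 'M[A]_m) (l : A) :
  (char_poly Q).[l] = \det (l%:M - Q).
Proof.
rewrite -horner_evalE -det_map_mx; congr (\det _); apply/matrixP => i j.
by rewrite !mxE /= horner_evalE !hornerE hornerMn hornerX.
Qed.

Lemma det_rank1_update_neq0 (F : fieldType) (m : nat) (Q : 'M[F]_m)
    (l : F) (x : 'cV[F]_m) (u : 'rV[F]_m) :
  mup l (char_poly Q) = 1%N -> Q *m x = l *: x -> (u *m x) 0 0 = 1 ->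
  \det (l%:M - Q - x *m u) != 0.
Proof.
move=> l_simple Qx ux1.
have p_neq0 : char_poly Q != 0 by rewrite monic_neq0 ?char_poly_monic.
have : ('X - l%:P) ^+ 1 %| char_poly Q by rewrite -mup_geq // l_simple.
rewrite expr1 => /dvdpP[q pE].
have ql : q.[l] != 0.
  apply/negP; rewrite -/(root q l) root_factor_theorem => /dvdpP[r qE].
  have := mup_leq l 1 p_neq0; rewrite l_simple leqnn => /esym.
  by rewrite pE qE -mulrA -expr2 dvdp_mulIr.
(* Cancelling [X - l] leaves [q * (X - (l + 1))], whose value at [l] is [- q.[l]]. *)
have := char_poly_rank1_update u Qx; rewrite ux1 pE mulrAC mulrC.
move=> /(mulIf (negbT (polyXsubC_eq0 l))) chiE.
rewrite -addrA -opprD -horner_char_poly chiE !hornerE mulf_neq0 //.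
by rewrite opprD addrA subrr add0r oppr_eq0 oner_neq0.
Qed.

(** * Eliminating the left eigenvector *)

(** The adjugate form avoids inverses, so no invertibility is assumed and limits can be taken entry
    by entry. *)
Lemma left_eigenvector_adj (F : fieldType) (m : nat) (M : 'M[F]_m) (mu : F)
    (v u : 'rV[F]_m) (x : 'cV[F]_m) :
  v *m M = mu *: v ->
  \det (mu%:M - M - x *m u) *: v =
    - ((v *m x) 0 0 *: (u *m \adj (mu%:M - M - x *m u))).
Proof.
move=> vM; rewrite -[LHS]mul_mx_scalar -mul_mx_adj mulmxA !mulmxBr vM.
rewrite mul_mx_scalar subrr sub0r mulmxA (mx11_scalar (v *m x)) mul_scalar_mx.
by rewrite mulNmx -scalemxAl -mx11_scalar.
Qed.

Lemma exists_dual_row (F : fieldType) (m : nat) (x : 'cV[F]_m) :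
  x != 0 -> exists u : 'rV[F]_m, (u *m x) 0 0 = 1.
Proof.
move=> /cV0Pn[i xi]; exists ((x i 0)^-1 *: delta_mx 0 i).
by rewrite -scalemxAl -rowE !mxE mulVf.
Qed.

(** If [y x = 0], the adjugate identity makes a nonzero multiple of [y] vanish; the multiple is
    nonzero because [l] is simple. *)
Lemma left_right_eigenvector_neq0 (F : fieldType) (m : nat) (Q : 'M[F]_m)
    (l : F) (x : 'cV[F]_m) (y : 'rV[F]_m) :
  mup l (char_poly Q) = 1%N -> Q *m x = l *: x -> y *m Q = l *: y ->
  x != 0 -> y != 0 -> (y *m x) 0 0 != 0.
Proof.
move=> l_simple Qx yQ /exists_dual_row[u ux1] y_neq0.
apply: contra_neq y_neq0 => yx0.
have := left_eigenvector_adj u x yQ; rewrite yx0 scale0r oppr0 => /eqP.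
by rewrite scaler_eq0 (negPf (det_rank1_update_neq0 l_simple Qx ux1)) => /eqP.
Qed.

(** A left eigenvector [v] applied to [x] gives [(mu - l) v x = t v E x]. Substitute the adjugate
    expression for [v] on the right and cancel [v x], which is nonzero since otherwise [v = 0]. *)
Lemma perturbed_eigenvalue_eq (F : fieldType) (m : nat) (Q E : 'M[F]_m)
    (l mu t : F) (x : 'cV[F]_m) (u : 'rV[F]_m) :
  let C := mu%:M - (Q + t *: E) - x *m u in
  Q *m x = l *: x -> eigenvalue (Q + t *: E) mu -> \det C != 0 ->
  (mu - l) * \det C = - (t * (u *m \adj C *m E *m x) 0 0).
Proof.
move=> C Qx /eigenvalueP[v vM v_neq0] detC.
have vadj := left_eigenvector_adj u x vM; rewrite -/C in vadj.
have vx_neq0 : (v *m x) 0 0 != 0.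
  apply: contra_neq v_neq0 => vx0; move/eqP: vadj.
  by rewrite vx0 scale0r oppr0 scaler_eq0 (negPf detC) => /eqP.
have vEx : (mu - l) *: (v *m x) = t *: (v *m E *m x).
  rewrite scalerBl [mu *: _]scalemxAl -vM mulmxDr mulmxDl -!mulmxA Qx -scalemxAl.
  by rewrite !scalemxAr addrC addKr.
apply: (mulfI vx_neq0); move: (congr1 (fun M => (M *m E *m x) 0 0) vadj).
move: (congr1 (fun M : 'M[F]_1 => M 0 0) vEx).
rewrite -!scalemxAl !mulNmx -!scalemxAl !mxE.
set p := \sum_j _; set q := \sum_j _; set r := \sum_j _ => H1 H2.
by rewrite mulrA [p * _]mulrC H1 mulrAC -mulrA H2; ring.
Qed.

(** * Entrywise limits of determinants, adjugates and products *)

Lemma cvg_det (K : numFieldType) (T : Type) (F : set_system T) (m : nat)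
    (M : T -> 'M[K]_m) (A : 'M[K]_m) : Filter F ->
  (forall i j, (M t i j : K^o) @[t --> F] --> (A i j : K^o)) ->
  (\det (M t) : K^o) @[t --> F] --> (\det A : K^o).
Proof.
move=> FF MA; rewrite /determinant.
apply: (@cvg_big K^o); first exact: add_continuous.
move=> s _; apply: cvgM; first exact: cvg_cst.
by apply: (@cvg_big K^o) => //; exact: mul_continuous.
Qed.

Lemma cvg_adj (K : numFieldType) (T : Type) (F : set_system T) (m : nat)
    (M : T -> 'M[K]_m) (A : 'M[K]_m) : Filter F ->
  (forall i j, (M t i j : K^o) @[t --> F] --> (A i j : K^o)) ->
  forall i j, (\adj (M t) i j : K^o) @[t --> F] --> (\adj A i j : K^o).
Proof.
move=> FF MA i j; rewrite mxE; under eq_fun do rewrite mxE.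
apply: cvgM; first exact: cvg_cst.
apply: cvg_det => a b; rewrite !mxE; under eq_fun do rewrite !mxE.
exact: MA.
Qed.

Lemma cvg_mulmx (K : numFieldType) (T : Type) (F : set_system T) (m n p : nat)
    (M : T -> 'M[K]_(m, n)) (A : 'M[K]_(m, n))
    (N : T -> 'M[K]_(n, p)) (B : 'M[K]_(n, p)) : Filter F ->
  (forall i j, (M t i j : K^o) @[t --> F] --> (A i j : K^o)) ->
  (forall i j, (N t i j : K^o) @[t --> F] --> (B i j : K^o)) ->
  forall i j, ((M t *m N t) i j : K^o) @[t --> F] --> ((A *m B) i j : K^o).
Proof.
move=> FF MA NB i j; rewrite mxE; under eq_fun do rewrite mxE.
apply: (@cvg_big K^o); first exact: add_continuous.
by move=> k _; apply: cvgM.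
Qed.

Lemma cvg_real_complex0 (R : realType) :
  (t%:C : R[i]^o) @[t --> (0 : R)] --> (0 : R[i]^o).
Proof.
(* A positive radius in [R[i]] has zero imaginary part. *)
apply/cvgr0Pnorm_lt => -[a b]; rewrite ltcE /= => /andP[/eqP-> a_gt0].
near=> t; rewrite normc_def /= expr0n addr0 sqrtr_sqr ltcR.
by near: t; exists a => // t /=; rewrite sub0r normrN.
Unshelve. all: by end_near.
Qed.

(** * Derivative of a simple eigenvalue *)

Lemma simple_eigenvalue_cderive (R : realType) (m : nat) (Q E : 'M[R[i]]_m)
    (l : R[i]) (x : 'cV[R[i]]_m) (y : 'rV[R[i]]_m) (mu : R -> R[i]^o) :
  mup l (char_poly Q) = 1%N -> Q *m x = l *: x -> y *m Q = l *: y ->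
  x != 0 -> y != 0 ->
  (\forall t \near (0 : R), eigenvalue (Q + t%:C *: E) (mu t)) ->
  mu t @[t --> (0 : R)] --> (l : R[i]^o) ->
  is_cderive mu 0 ((y *m E *m x) 0 0 / (y *m x) 0 0).
Proof.
move=> l_simple Qx yQ x_neq0 y_neq0 mu_eig mu_cvg.
have yx_neq0 := left_right_eigenvector_neq0 l_simple Qx yQ x_neq0 y_neq0.
have [u ux1] := exists_dual_row x_neq0.
(* The filter at 0 is not punctured, so the limit fixes the value at 0. *)
have mu0 : mu 0 = l.
  apply/eqP/negPn/negP => mu0_neq.
  move/cvgrPdist_lt: mu_cvg => /(_ `|l - mu 0|).
  rewrite normr_gt0 subr_eq0 eq_sym => /(_ mu0_neq) /nbhs_singleton.
  by rewrite ltxx.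
pose C t := (mu t)%:M - (Q + t%:C *: E) - x *m u.
pose C0 := l%:M - Q - x *m u.
have det_neq0 : \det C0 != 0 := det_rank1_update_neq0 l_simple Qx ux1.
have yadj := left_eigenvector_adj u x yQ.
have C_cvg i j : (C t i j : R[i]^o) @[t --> (0:R)^'] --> (C0 i j : R[i]^o).
  apply: cvg_within_filter.
  rewrite !mxE; under eq_fun do rewrite !mxE.
  apply: cvgB; last exact: cvg_cst.
  apply: cvgB; first by apply: (@cvgMn R[i] R[i]^o).
  rewrite -[X in _ --> X]addr0; apply: cvgD; first exact: cvg_cst.
  rewrite -(mul0r (E i j)); apply: cvgM; last exact: cvg_cst.
  exact: cvg_real_complex0.
have detC_cvg : (\det (C t) : R[i]^o) @[t --> (0:R)^'] --> (\det C0 : R[i]^o).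
  exact: cvg_det.
have num_cvg : ((u *m \adj (C t) *m E *m x) 0 0 : R[i]^o) @[t --> (0:R)^']
    --> ((u *m \adj C0 *m E *m x) 0 0 : R[i]^o).
  apply: cvg_mulmx => [i j|i j]; last exact: cvg_cst.
  apply: (cvg_mulmx (N := fun=> E)) => {}i {}j; last exact: cvg_cst.
  apply: (cvg_mulmx (M := fun=> u)) => {}i {}j; first exact: cvg_cst.
  exact: cvg_adj.
have lim_cvg := cvgM (cvgN num_cvg) (cvgV det_neq0 detC_cvg).
rewrite /is_cderive.
(* The adjugate identity for [y] and the unperturbed [Q], applied to [E x], identifies the limit. *)
have -> : (y *m E *m x) 0 0 / (y *m x) 0 0 =
    - (u *m \adj C0 *m E *m x) 0 0 / \det C0.
  apply/eqP; rewrite eqr_div //; apply/eqP.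
  move: (congr1 (fun v => (v *m E *m x) 0 0) yadj).
  rewrite -/C0 -!scalemxAl !mulNmx -!scalemxAl => detE.
  by move: detE; rewrite !mxE => detE; rewrite mulrC detE mulNr mulrC.
apply: cvg_trans (lim_cvg _ _ _); apply: near_eq_cvg; near=> h.
rewrite /= add0r mu0.
have h_neq0 : h%:C != 0 :> R[i].
  by rewrite fmorph_eq0; near: h; exact: nbhs_dnbhs_neq.
have detC_neq0 : \det (C h) != 0.
  by near: h; exact: (cvgr_neq0 _ detC_cvg).
have mu_h : eigenvalue (Q + h%:C *: E) (mu h).
  by near: h; apply: cvg_within.
have /= := perturbed_eigenvalue_eq Qx mu_h detC_neq0.
rewrite -/(C h) => key.
apply: (mulIf detC_neq0); rewrite mulfVK // fmorphV -mulrA key.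
by rewrite mulrN mulKf.
Unshelve. all: by end_near.
Qed.

(** * The Frobenius inner product *)

Section FrobeniusDot.
(* Here [z^*] must be [Num.conj z]; in complex_scope it is [conjc z]. *)
Local Open Scope ring_scope.
Variable C : numClosedFieldType.

Lemma trmxC_mul (m n p : nat) (A : 'M[C]_(m, n)) (B : 'M[C]_(n, p)) :
  (A *m B) ^t* = B ^t* *m A ^t*.
Proof. by rewrite trmx_mul map_mxM. Qed.

Lemma trmxCD (m n : nat) (A B : 'M[C]_(m, n)) : (A + B) ^t* = A ^t* + B ^t*.
Proof. by rewrite linearD map_mxD. Qed.

Lemma trmxCZ (m n : nat) (k : C) (A : 'M[C]_(m, n)) :
  (k *: A) ^t* = k^* *: A ^t*.
Proof. by rewrite linearZ map_mxZ. Qed.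

Definition frobenius_dot (m n : nat) (A B : 'M[C]_(m, n)) : C :=
  \tr (A ^t* *m B).

Section Dot.
Variables (m n : nat).
Implicit Types (A B D : 'M[C]_(m, n)) (k : C).

Lemma frobenius_dotDl A B D :
  frobenius_dot (A + B) D = frobenius_dot A D + frobenius_dot B D.
Proof. by rewrite /frobenius_dot trmxCD mulmxDl mxtraceD. Qed.

Lemma frobenius_dotDr A B D :
  frobenius_dot A (B + D) = frobenius_dot A B + frobenius_dot A D.
Proof. by rewrite /frobenius_dot mulmxDr mxtraceD. Qed.

Lemma frobenius_dotZl k A B :
  frobenius_dot (k *: A) B = k^* * frobenius_dot A B.
Proof. by rewrite /frobenius_dot trmxCZ -scalemxAl mxtraceZ. Qed.

Lemma frobenius_dotZr k A B : frobenius_dot A (k *: B) = k * frobenius_dot A B.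
Proof. by rewrite /frobenius_dot -scalemxAr mxtraceZ. Qed.

Lemma frobenius_dotC A B : frobenius_dot B A = (frobenius_dot A B)^*.
Proof.
by rewrite /frobenius_dot -trace_map_mx map_mxM -map_trmx map_mxCK
  -[in RHS]mxtrace_tr trmx_mul trmxK.
Qed.

Lemma frobenius_dotE A : frobenius_dot A A = \sum_i \sum_j `|A i j| ^+ 2.
Proof.
rewrite exchange_big /frobenius_dot /mxtrace; apply: eq_bigr => j _.
by rewrite mxE; apply: eq_bigr => i _; rewrite !mxE normCKC.
Qed.

Lemma frobenius_dot_ge0 A : 0 <= frobenius_dot A A.
Proof.
rewrite frobenius_dotE; apply: sumr_ge0 => i _; apply: sumr_ge0 => j _.
exact: exprn_ge0.
Qed.

End Dot.
End FrobeniusDot.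

Lemma frobenius_normE (R : realType) (m n : nat) (A : 'M[R[i]]_(m, n)) :
  frobenius_norm A = sqrtC (frobenius_dot A A).
Proof. by rewrite frobenius_dotE. Qed.

Lemma euclidean_norm1 (R : realType) (n : nat) (x : 'cV[R[i]]_n) :
  euclidean_norm x = 1 -> x ^t* *m x = 1%:M.
Proof.
move=> /(congr1 (fun z => z ^+ 2)); rewrite /euclidean_norm sqrtCK expr1n => x1.
rewrite [LHS]mx11_scalar; congr _%:M; rewrite mxE -x1.
by apply: eq_bigr => i _; rewrite !mxE normCKC.
Qed.

(** * Hamiltonian matrices and the involution [A -> J A^* J] *)

Section Symplectic.
Local Open Scope ring_scope.
Variables (R : realType) (n : nat).
Notation J := (@sympJ R n).
Implicit Types (A G : 'M[R[i]]_(n + n)) (x y : 'cV[R[i]]_(n + n)).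

Lemma sympJ_sqr : J *m J = - 1%:M.
Proof.
rewrite /sympJ mulmx_block !mul0mx !mulmx0 !mulmx1 !mul1mx ?addr0 ?add0r.
by rewrite -!raddfN -scalar_mx_block.
Qed.

Lemma trmxC_sympJ : J ^t* = - J.
Proof.
rewrite /sympJ tr_block_mx map_block_mx opp_block_mx !trmx0 !map_mx0 !oppr0.
by rewrite opprK linearN /= !trmx1 map_mxN map_mx1.
Qed.

(** Follows from [J^2 = -1] and [J^* = -J]. In this fixed-point form [ham_proj] is the average over
    an involution. *)
Lemma hamiltonianP A : hamiltonian A <-> J *m A ^t* *m J = A.
Proof.
rewrite /hamiltonian trmxC_mul trmxC_sympJ; split=> H.
  have -> : J *m A ^t* = - (A *m J) by rewrite H mulNmx opprK.
  by rewrite mulNmx -mulmxA sympJ_sqr mulmxN mulmx1 opprK.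
by rewrite -[in LHS]H -!mulmxA sympJ_sqr !mulmxN mulmx1 mulNmx.
Qed.

Lemma sympJ_conjK A : J *m (J *m A ^t* *m J) ^t* *m J = A.
Proof.
rewrite !trmxC_mul trmxC_sympJ trmxCK !mulNmx !mulmxN opprK !mulmxA.
by rewrite sympJ_sqr -!mulmxA sympJ_sqr !mulNmx !mulmxN mul1mx mulmx1 opprK.
Qed.

Lemma hamiltonian_ham_proj A : hamiltonian (ham_proj A).
Proof.
apply/hamiltonianP; rewrite /ham_proj trmxCZ -scalemxAr -scalemxAl.
rewrite fmorphV rmorph_nat trmxCD mulmxDr mulmxDl.
by rewrite sympJ_conjK addrC.
Qed.

Lemma hamiltonianZ (k : R[i]) A :
  k^* = k -> hamiltonian A -> hamiltonian (k *: A).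
Proof.
by move=> kR; rewrite /hamiltonian -scalemxAl trmxCZ kR => {1}->.
Qed.

End Symplectic.

(** * The sharp bound on [y^* G x] *)

Section Bound.
Local Open Scope ring_scope.
Variables (R : realType) (n : nat).
Notation J := (@sympJ R n).
Variables (x y : 'cV[R[i]]_(n + n)).
Hypotheses (x1 : x ^t* *m x = 1%:M) (y1 : y ^t* *m y = 1%:M).
Let c := scalar_of (y ^t* *m J *m x).
Hypothesis c_real : 'Im c = 0.

Let a := y *m x ^t*.
Let b := J *m a ^t* *m J.

Let cK : c^* = c.
Proof. by apply/CrealP/Creal_ImP. Qed.

Let c_mx : y ^t* *m J *m x = c%:M.
Proof. exact: mx11_scalar. Qed.

Let dot_outer (A : 'M[R[i]]_(n + n)) :
  frobenius_dot a A = scalar_of (y ^t* *m A *m x).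
Proof.
rewrite /frobenius_dot /a trmxC_mul trmxCK -mulmxA mxtrace_mulC.
exact: trace_mx11.
Qed.

Let dot_reflected (A : 'M[R[i]]_(n + n)) :
  frobenius_dot b A = scalar_of (x ^t* *m J *m A *m J *m y).
Proof.
rewrite /frobenius_dot /b /a !trmxC_mul !trmxCK trmxC_sympJ.
rewrite [_ *m A](_ : _ = (J *m y) *m (x ^t* *m J *m A)); last first.
  by rewrite !mulmxN !mulNmx ?opprK !mulmxA.
by rewrite mxtrace_mulC trace_mx11 /scalar_of !mulmxA.
Qed.

Let dot_aa : frobenius_dot a a = 1.
Proof. by rewrite dot_outer /a /scalar_of -!mulmxA x1 mulmx1 y1 mxE eqxx. Qed.

Let dot_ab : frobenius_dot a b = c ^+ 2.
Proof.
rewrite dot_outer /b /a trmxC_mul trmxCK /scalar_of !mulmxA c_mx -!mulmxA.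
by rewrite mul_scalar_mx mulmxA c_mx !mxE eqxx expr2.
Qed.

Let dot_ba : frobenius_dot b a = c ^+ 2.
Proof. by rewrite frobenius_dotC dot_ab rmorphXn /= cK. Qed.

Let dot_bb : frobenius_dot b b = 1.
Proof.
have JJ (B : 'M[R[i]]_(n + n, 1)) : J *m (J *m B) = - B.
  by rewrite mulmxA sympJ_sqr mulNmx mul1mx.
rewrite dot_reflected /b /a trmxC_mul trmxCK /scalar_of -!mulmxA !JJ.
by rewrite !(mulmxN, mulNmx) opprK y1 mulmx1 x1 !mxE eqxx.
Qed.

(** For a fixed point of the involution, [J G J = G^*]. *)
Let dot_b_ham G :
  hamiltonian G -> frobenius_dot b G = (frobenius_dot a G)^*.
Proof.
move=> /hamiltonianP GE; rewrite dot_reflected dot_outer /scalar_of.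
have -> : x ^t* *m J *m G *m J *m y = (y ^t* *m G *m x) ^t*.
  rewrite !trmxC_mul trmxCK -[in LHS]GE !mulmxA.
  rewrite -[x ^t* *m J *m J]mulmxA sympJ_sqr -[_ *m J *m J]mulmxA sympJ_sqr.
  by rewrite !mulmxN !mulmx1 !mulNmx opprK.
by rewrite !mxE.
Qed.

Let P := ham_proj a.

Let PE : P = 2^-1 *: (a + b).
Proof. by []. Qed.

Let c_sqr_ge0 : 0 <= c ^+ 2.
Proof. by rewrite real_exprn_even_ge0 //; apply/Creal_ImP. Qed.

(** Both sides expand to [(1 + c ^+ 2) / 2]. This makes the normalized [P] attain the bound. *)
Lemma frobenius_dot_outer_ham_proj :
  scalar_of (y ^t* *m P *m x) = frobenius_norm P ^+ 2.
Proof.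
rewrite frobenius_normE sqrtCK -dot_outer PE.
rewrite !(frobenius_dotZl, frobenius_dotZr, frobenius_dotDl, frobenius_dotDr).
rewrite dot_aa dot_ab dot_ba dot_bb fmorphV rmorph_nat.
by field.
Qed.

Lemma frobenius_norm_ham_proj_sqr : frobenius_norm P ^+ 2 = (1 + c ^+ 2) / 2.
Proof.
rewrite -frobenius_dot_outer_ham_proj -dot_outer PE.
by rewrite frobenius_dotZr frobenius_dotDr dot_aa dot_ab mulrC.
Qed.

Lemma frobenius_norm_ham_proj_gt0 : 0 < frobenius_norm P.
Proof.
rewrite frobenius_normE sqrtC_gt0 -[frobenius_dot _ _]sqrtCK -frobenius_normE.
by rewrite frobenius_norm_ham_proj_sqr divr_gt0 // ltr_wpDr.
Qed.

Lemma norm_outer_le_ham_proj G :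
  hamiltonian G -> frobenius_norm G = 1 ->
  `|scalar_of (y ^t* *m G *m x)| <= frobenius_norm P.
Proof.
move=> Gham G1; set z := scalar_of _.
have dot_aG : frobenius_dot a G = z by rewrite dot_outer.
have dot_bG : frobenius_dot b G = z^* by rewrite dot_b_ham ?dot_aG.
have dot_GG : frobenius_dot G G = 1.
  by rewrite -[LHS]sqrtCK -frobenius_normE G1 expr1n.
have P_ge0 := ltW frobenius_norm_ham_proj_gt0.
have [->|z_neq0] := eqVneq z 0; first by rewrite normr0.
(* [S] is twice the projection of [z *: a], and [k] is its inner product with [G], so [k *: G] is
   the component of [S] along the unit matrix [G]. *)
pose k := 2 * `|z| ^+ 2.
pose S := z *: a + z^* *: b.
have kK : k^* = k by rewrite rmorphM rmorph_nat rmorphXn /= conj_normC.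
have zz : z^* * z = `|z| ^+ 2 by rewrite normCKC.
have SG : frobenius_dot S G = k.
  rewrite /S frobenius_dotDl !frobenius_dotZl dot_aG dot_bG conjCK mulrC.
  by rewrite -normCK /k; ring.
have SS : frobenius_dot S S = k + (z ^+ 2 + z^* ^+ 2) * c ^+ 2.
  rewrite /S !(frobenius_dotDl, frobenius_dotDr, frobenius_dotZl, frobenius_dotZr).
  rewrite dot_aa dot_ab dot_ba dot_bb conjCK /k -zz; ring.
have zz_le : z ^+ 2 + z^* ^+ 2 <= k.
  rewrite -subr_ge0; have -> : k - (z ^+ 2 + z^* ^+ 2) = `|z - z^*| ^+ 2.
    by rewrite normCK rmorphB /= conjCK /k -zz; ring.
  exact: exprn_ge0.
(* The sign of [c ^+ 2] matters here: it allows [zz_le] to be multiplied by it. *)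
have SS_le : frobenius_dot S S <= 2 * k * frobenius_norm P ^+ 2.
  rewrite SS frobenius_norm_ham_proj_sqr.
  have -> : 2 * k * ((1 + c ^+ 2) / 2) = k + k * c ^+ 2 by field.
  by rewrite lerD2l ler_wpM2r.
(* Cauchy-Schwarz against [G]; [S] is made opaque so that only [S - k *: G] is expanded. *)
clearbody S; have kk_le : k ^+ 2 <= frobenius_dot S S.
  rewrite -subr_ge0.
  have -> : frobenius_dot S S - k ^+ 2 = frobenius_dot (S - k *: G) (S - k *: G).
    rewrite -scaleNr.
    rewrite !(frobenius_dotDl, frobenius_dotDr, frobenius_dotZl, frobenius_dotZr).
    by rewrite (frobenius_dotC S G) SG dot_GG rmorphN /= kK; ring.
  exact: frobenius_dot_ge0.
rewrite -(ler_pXn2r (n := 2)) ?nnegrE //.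
(* As [k ^+ 2 = 2 * k * |z|^2], the two estimates on [S] differ from the goal by the factor
   [2 * k]. *)
have k2_gt0 : 0 < 2 * k by rewrite /k !mulr_gt0 ?exprn_gt0 ?normr_gt0.
rewrite -(ler_pM2l k2_gt0); apply: le_trans SS_le; apply: le_trans kk_le.
by have -> : 2 * k * `|z| ^+ 2 = k ^+ 2 by rewrite /k; ring.
Qed.

End Bound.

(** * The maximum and the extremal perturbations *)

Theorem theorem2p2 (R : realType) (n : nat) (Q : 'M[R[i]]_(n + n))
    (lambda : R[i]) (x y : 'cV[R[i]]_(n + n)) :
  hamiltonian Q ->
  simple_eigenvalue Q lambda ->
  Q *m x = lambda *: x ->
  y ^t* *m Q = lambda *: y ^t* ->
  euclidean_norm x = 1 ->
  euclidean_norm y = 1 ->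
  'Im (scalar_of (y ^t* *m sympJ *m x)) = 0 ->
  let P := ham_proj (y *m x ^t*) in
  let yx := scalar_of (y ^t* *m x) in
  is_maximum
    [set `|scalar_of (y ^t* *m G *m x) / yx| | G in
       [set G : 'M[R[i]]_(n + n) | frobenius_norm G = 1 /\ hamiltonian G]]
    (frobenius_norm P / `|yx|) /\
  forall (E : 'M[R[i]]_(n + n)) (lambdaE : R -> R[i]^o),
    hamiltonian E ->
    frobenius_norm E = 1 ->
    (\forall t \near (0 : R), eigenvalue (Q + t%:C *: E) (lambdaE t)) ->
    lambdaE t @[t --> (0 : R)] --> (lambda : R[i]^o) ->
    exists dlambda : R[i],
      [/\ is_cderive lambdaE 0 dlambda,
          `|dlambda| <= frobenius_norm P / `|yx|,
          E = (frobenius_norm P)^-1 *: P ->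
            dlambda = frobenius_norm P / yx &
          E = - ((frobenius_norm P)^-1 *: P) ->
            dlambda = - (frobenius_norm P / yx)].
Proof.
move=> Qham [_ l_simple] Qx yQ x_norm y_norm c_real P yx.
have x1 := euclidean_norm1 x_norm; have y1 := euclidean_norm1 y_norm.
have P_gt0 : 0 < frobenius_norm P := frobenius_norm_ham_proj_gt0 x1 y1 c_real.
(* Hamiltonian matrices form only a real-linear space, so the scaling factor must be
   self-conjugate. *)
have PV_real : Num.conj (frobenius_norm P)^-1 = (frobenius_norm P)^-1.
  by apply/CrealP; rewrite realV ger0_real // ltW.
(* Taking [k] to be plus or minus the inverse norm of [P] gives the maximizer and both extremal
   perturbations. *)
have yPx (k : R[i]) : scalar_of (y ^t* *m (k *: P) *m x) =
    k * frobenius_norm P ^+ 2.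
  rewrite -(frobenius_dot_outer_ham_proj x1 y1 c_real) /scalar_of.
  by rewrite -scalemxAr -scalemxAl mxE.
have bound G : hamiltonian G -> frobenius_norm G = 1 ->
    `|scalar_of (y ^t* *m G *m x) / yx| <= frobenius_norm P / `|yx|.
  move=> Gham G1; rewrite normf_div ler_wpM2r ?invr_ge0 //.
  exact: (norm_outer_le_ham_proj x1 y1 c_real).
have x_neq0 : x != 0.
  apply: contra_eq_neq x1 => ->; rewrite mulmx0 eq_sym.
  by apply/eqP => /matrixP/(_ 0 0)/eqP; rewrite !mxE eqxx oner_eq0.
have y_neq0 : y ^t* != 0.
  apply: contra_eq_neq y1 => ->; rewrite mul0mx eq_sym.
  by apply/eqP => /matrixP/(_ 0 0)/eqP; rewrite !mxE eqxx oner_eq0.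
split; first split.
- exists ((frobenius_norm P)^-1 *: P); last first.
    rewrite yPx expr2 mulKf ?gt_eqF // normf_div ger0_norm //.
    exact: ltW.
  split; last by apply: hamiltonianZ => //; exact: hamiltonian_ham_proj.
  rewrite frobenius_normE frobenius_dotZl frobenius_dotZr PV_real mulrA -expr2.
  rewrite -[frobenius_dot P P]sqrtCK -frobenius_normE -exprMn mulVf ?gt_eqF //.
  by rewrite expr1n sqrtC1.
- by move=> _ [G [G1 Gham] <-]; exact: bound.
move=> E lambdaE Eham E1 eig cvg.
exists (scalar_of (y ^t* *m E *m x) / yx); split.
- exact: (simple_eigenvalue_cderive l_simple Qx yQ x_neq0 y_neq0 eig cvg).
- exact: bound.
- by move=> ->; rewrite yPx expr2 mulKf ?gt_eqF.
- move=> ->; rewrite -scaleNr yPx mulNr expr2 mulKf ?gt_eqF //.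
  by rewrite mulNr.
Qed.
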